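(* Let $a$ and $b$ be positive integers. If $\frac{a}{b} < \frac{22}{5}$, then there exists a planar graph $G$ such that $G$ is not $(a:b)$-choosable.
   Context: All graphs are finite and simple. For an assignment $L$ of lists (finite sets) of colors to the vertices of a graph $G$, a $b$-fold $L$-coloring of $G$ is a mapping $\varphi$ that assigns to each vertex $v$ a set $\varphi(v)\subseteq L(v)$ with $|\varphi(v)| = b$, such that $\varphi(u)\cap\varphi(v)=\varnothing$ whenever $u$ and $v$ are adjacent. For positive integers $a,b$, a graph $G$ is $(a:b)$-choosable if, for each list assignment $L$ with $|L(v)| = a$ for every vertex $v$, $G$ admits a $b$-fold $L$-coloring. *)

(* Defs.v *)
From HB Require Import structures.
From mathcomp Require Import all_boot all_order all_algebra.
From mathcomp Require Import finmap.
From mathcomp Require Import all_classical all_reals all_analysis.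
Import Order.TTheory GRing.Theory Num.Theory.
Import numFieldNormedType.Exports.

Set Implicit Arguments.
Unset Strict Implicit.
Unset Printing Implicit Defensive.

Local Open Scope classical_set_scope.
Local Open Scope ring_scope.

Record sgraph := SGraph {
  vertex :> finType;
  adj : rel vertex;
  adj_sym : symmetric adj;
  adj_irr : irreflexive adj }.

(* A drawing of G in the plane R^2 without crossings. The curve of the edge   *)
(* uv, parametrized from u to v, is t |-> arc u v t with t ranging over       *)
(* [0, 1]; arc u v is unconstrained outside [0, 1], and when u and v are not  *)
(* adjacent.                                                                  *)
Record plane_drawing (R : realType) (G : sgraph) (pos : G -> R * R)
    (arc : G -> G -> R -> R * R) : Prop := PlaneDrawing {
  pos_inj : injective pos;
  arc_cont : forall u v, adj u v ->
    {within `[0, 1], continuous (arc u v)};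
  arc_inj : forall u v, adj u v -> {in `[0, 1] &, injective (arc u v)};
  arc_src : forall u v, adj u v -> arc u v 0 = pos u;
  arc_tgt : forall u v, adj u v -> arc u v 1 = pos v;
  (* uv and vu are the same edge, hence the same curve *)
  arc_rev : forall u v, adj u v ->
    {in `[0, 1], forall t, arc v u t = arc u v (1 - t)};
  arc_avoids_pos : forall u v w, adj u v ->
    {in `]0, 1[, forall t, arc u v t <> pos w};
  arc_avoids_arc : forall u v x y, adj u v -> adj x y ->
    [set u; v]%SET != [set x; y]%SET ->
    {in `]0, 1[ & `[0, 1], forall s t, arc u v s <> arc x y t} }.

Definition planar (R : realType) (G : sgraph) : Prop :=
  exists (pos : G -> R * R) (arc : G -> G -> R -> R * R), plane_drawing pos arc.

Definition fold_coloring (G : sgraph) (C : choiceType) (L : G -> {fset C})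
    (b : nat) (phi : G -> {fset C}) : Prop :=
  [/\ forall v, (phi v `<=` L v)%fset,
      forall v, #|` phi v|%fset = b
    & forall u v, adj u v -> (phi u `&` phi v)%fset = fset0].

Definition choosable (a b : nat) (G : sgraph) : Prop :=
  forall (C : choiceType) (L : G -> {fset C}),
    (forall v, #|` L v|%fset = a) ->
    exists phi : G -> {fset C}, fold_coloring L b phi.

(* Main.v *)
(* Shrinking lists, one may assume a = 4b + e with 0 <= e and 5e < 2b. Take two
   poles x, y with disjoint lists and, for each pair (A, B) of b-subsets of
   these lists, a gadget between x and y which cannot be coloured when x and y
   get A and B. Each half of the gadget has vertices u1, u2, u3, w1, w2, w3, z
   numbered 0, ..., 6; the two halves are mirror images joined by the edge zz',
   and x is adjacent to u1, u2, w1, w2, z, and y to u1, u3, w1, w3, z. With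
   pairwise disjoint palettes P, E, Q, T, S of sizes 2b, e, b + e, b, 2b + e,
   counting the colours available to
   - the triangle u1 u2 u3 shows that w1 uses at most e colours of T, hence at
     least b - e colours of Q, since its list is A, B, Q, T;
   - the edge w2w3 then shows that z uses at most 2e colours of P.
   As z and z' have list A, B, P, E, together they use at most 5e colours, but
   they need 2b.
   For planarity, the gadgets are put side by side near the horizontal axis, the
   poles very high and very low on the vertical axis, and edges are straight. *)

Require Import Defs.
From mathcomp Require Import all_boot all_order all_algebra finmap.
From mathcomp Require Import all_classical all_reals all_analysis.
From mathcomp Require Import ring lra zify.
Import Order.TTheory GRing.Theory Num.Theory.
Import numFieldNormedType.Exports.

Set Implicit Arguments.
Unset Strict Implicit.
Unset Printing Implicit Defensive.

Local Open Scope fset_scope.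
Local Open Scope nat_scope.

(** * The graph: gadgets between two poles *)

Definition mirror (i : nat) : nat := if i < 7 then i else 13 - i.

Definition half_edges : seq (nat * nat) :=
  [:: (0, 1); (0, 2); (1, 2); (1, 3); (2, 3);
      (3, 4); (3, 5); (4, 5); (4, 6); (5, 6)].

(** Vertices 0 to 6 form one half, and 13 - i is the mirror image of i. The [else] branch is the
    edge zz', between 6 and 7. *)
Definition inner_adj (i j : nat) : bool :=
  if (i < 7) == (j < 7)
  then ((mirror i, mirror j) \in half_edges)
    || ((mirror j, mirror i) \in half_edges)
  else (mirror i == 6) && (mirror j == 6).

Definition half_pole (p : bool) : seq nat :=
  if p then [:: 0; 1; 3; 4; 6] else [:: 0; 2; 3; 5; 6].

Definition pole_adj (p : bool) (i : nat) : bool := mirror i \in half_pole p.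

(* [inl] are the poles; [inr (g, i)] is the vertex [i] of the gadget [g]. *)
Definition bipolar_adj (I : finType) (u v : (bool + I * 'I_14)%type) : bool :=
  match u, v with
  | inl _, inl _ => false
  | inl p, inr gi => pole_adj p gi.2
  | inr gi, inl p => pole_adj p gi.2
  | inr gi, inr hj => (gi.1 == hj.1) && inner_adj gi.2 hj.2
  end.

Lemma bipolar_adj_sym (I : finType) : symmetric (@bipolar_adj I).
Proof.
move=> [p|[g i]] [q|[h j]] //=.
rewrite /inner_adj [g == h]eq_sym [(i < 7) == _]eq_sym.
by case: ifP => _; congr (_ && _); [exact: orbC | exact: andbC].
Qed.

Lemma bipolar_adj_irr (I : finType) : irreflexive (@bipolar_adj I).
Proof.
move=> [p|[g i]] //=; rewrite /inner_adj !eqxx orbb /=.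
have : all (fun i => (mirror i, mirror i) \notin half_edges) (iota 0 14) by [].
by move=> /allP/(_ i); rewrite mem_iota ltn_ord => /(_ isT)/negbTE.
Qed.

Definition bipolar (I : finType) : sgraph :=
  SGraph (@bipolar_adj_sym I) (@bipolar_adj_irr I).

(** * Counting colours in half a gadget *)

Lemma cardfsU_le (K : choiceType) (A B : {fset K}) :
  #|` A `|` B| <= #|` A| + #|` B|.
Proof. by rewrite cardfsU leq_subr. Qed.

Lemma cardfsU_disjoint (K : choiceType) (A B : {fset K}) :
  A `&` B = fset0 -> #|` A `|` B| = #|` A| + #|` B|.
Proof. by move=> AB; rewrite cardfsU AB cardfs0 subn0. Qed.

Lemma fsetI0_notin (K : choiceType) (A B : {fset K}) x :
  A `&` B = fset0 -> x \in A -> x \notin B.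
Proof.
move=> AB xA; apply/negP => xB.
by have := in_fset0 x; rewrite -AB in_fsetI xA xB.
Qed.

(** [A] or [B] occurs exactly where the pole using it is adjacent, so it is lost there: 2b + e
    colours remain next to both poles, 3b + e next to one. *)
Definition half_list (K : choiceType) (A B P E Q T S : {fset K}) (i : nat) :
    {fset K} :=
  match i with
  | 0 => A `|` B `|` S
  | 1 => A `|` (T `|` S)
  | 2 => B `|` (T `|` S)
  | 3 => A `|` B `|` (Q `|` T)
  | 4 => A `|` (P `|` Q)
  | 5 => B `|` (P `|` Q)
  | _ => A `|` B `|` (P `|` E)
  end.

Lemma half_bound (K : choiceType) (b e : nat) (A B P E Q T S : {fset K})
    (f : nat -> {fset K}) :
  #|` P| = 2 * b -> #|` Q| = b + e -> #|` T| = b -> #|` S| = 2 * b + e ->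
  (forall i, i < 7 -> #|` f i| = b) ->
  (forall i, i < 7 -> f i `<=` half_list A B P E Q T S i) ->
  (forall i, i \in half_pole true -> A `&` f i = fset0) ->
  (forall i, i \in half_pole false -> B `&` f i = fset0) ->
  (forall i j, (i, j) \in half_edges -> f i `&` f j = fset0) ->
  #|` P `&` f 6| <= 2 * e.
Proof.
move=> cP cQ cT cS cf fL fA fB fE.
have inL i x : i < 7 -> x \in f i -> x \in half_list A B P E Q T S i.
  by move=> /fL/fsubsetP; apply.
have notA i x : i \in half_pole true -> x \in f i -> x \notin A.
  by move=> /fA; rewrite fsetIC; apply: fsetI0_notin.
have notB i x : i \in half_pole false -> x \in f i -> x \notin B.
  by move=> /fB; rewrite fsetIC; apply: fsetI0_notin.
have notE i j x : (i, j) \in half_edges -> x \in f i -> x \notin f j.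
  by move=> /fE; apply: fsetI0_notin.
have notE' i j x : (i, j) \in half_edges -> x \in f j -> x \notin f i.
  by move=> /fE; rewrite fsetIC; apply: fsetI0_notin.
(* The triangle needs 3b colours, all in [S] or in the part of [T] that vertex 3 leaves free. *)
have T3 : #|` T `&` f 3| <= e.
  have sub : f 0 `|` f 1 `|` f 2 `<=` S `|` (T `\` f 3).
    apply/fsubsetP => x; rewrite !in_fsetU in_fsetD => /orP[/orP[]|] xf.
    - have := inL 0 x isT xf; rewrite !in_fsetU.
      by rewrite (negbTE (notA 0 x isT xf)) (negbTE (notB 0 x isT xf)) /= => ->.
    - have := inL 1 x isT xf; rewrite !in_fsetU.
      by rewrite (negbTE (notA 1 x isT xf)) (notE 1 3 x isT xf) /= orbC.
    - have := inL 2 x isT xf; rewrite !in_fsetU.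
      by rewrite (negbTE (notB 2 x isT xf)) (notE 2 3 x isT xf) /= orbC.
  have := leq_trans (fsubset_leq_card sub) (cardfsU_le _ _).
  rewrite !cardfsU_disjoint ?fsetIUl ?fE ?fsetU0 // !cf // cS.
  by have := cardfsID (f 3) T; lia.
have Q3 : b <= #|` Q `&` f 3| + e.
  have sub : f 3 `<=` (Q `&` f 3) `|` (T `&` f 3).
    apply/fsubsetP => x xf; rewrite -fsetIUl in_fsetI xf andbT.
    have := inL 3 x isT xf; rewrite !in_fsetU.
    by rewrite (negbTE (notA 3 x isT xf)) (negbTE (notB 3 x isT xf)).
  have := leq_trans (fsubset_leq_card sub) (cardfsU_le _ _).
  by rewrite cf //; lia.
(* The right side has 3b + e colours less those used by 6 in [P] and by 3 in [Q], and it must hold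
   2b. *)
have sub : f 4 `|` f 5 `<=` (P `\` f 6) `|` (Q `\` f 3).
  apply/fsubsetP => x; rewrite !in_fsetU !in_fsetD => /orP[] xf.
  - have := inL 4 x isT xf; rewrite !in_fsetU.
    by rewrite (negbTE (notA 4 x isT xf)) (notE 4 6 x isT xf)
      (notE' 3 4 x isT xf).
  - have := inL 5 x isT xf; rewrite !in_fsetU.
    by rewrite (negbTE (notB 5 x isT xf)) (notE 5 6 x isT xf)
      (notE' 3 5 x isT xf).
have := leq_trans (fsubset_leq_card sub) (cardfsU_le _ _).
rewrite cardfsU_disjoint ?fE // !cf //.
by have := cardfsID (f 6) P; have := cardfsID (f 3) Q; lia.
Qed.

(** * The lists, and why no colouring exists *)

Definition palette (c n : nat) : {fset nat * nat} :=
  [fset x in [seq (c, i) | i <- iota 0 n]].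

Lemma in_palette c n x : (x \in palette c n) = (x.1 == c) && (x.2 < n).
Proof.
rewrite !inE; apply/mapP/andP => [[i + ->] | [/eqP xc xn]].
  by rewrite mem_iota /= add0n eqxx.
by exists x.2; [rewrite mem_iota | rewrite -xc; case: (x)].
Qed.

Lemma card_palette c n : #|` palette c n| = n.
Proof.
rewrite card_fseq undup_id ?size_map ?size_iota //.
by rewrite map_inj_uniq ?iota_uniq // => i j [].
Qed.

Lemma palette_disjoint c d m n : c != d -> palette c m `&` palette d n = fset0.
Proof.
move=> cd; apply/fsetP => x; rewrite in_fsetI !in_palette in_fset0.
by apply/negP => /andP[/andP[/eqP-> _] /andP[/eqP E _]]; rewrite E eqxx in cd.
Qed.

(** Palettes with different tags are disjoint. Tags 0 and 1 are reserved for the lists of the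
    poles. *)
Definition gadget_list (b e : nat) (A B : {fset nat * nat}) :
    nat -> {fset nat * nat} :=
  half_list A B (palette 2 (2 * b)) (palette 3 e) (palette 4 (b + e))
    (palette 5 b) (palette 6 (2 * b + e)).

Lemma card_gadget_list b e n (A B : {fset nat * nat}) i :
  A `<=` palette 0 n -> B `<=` palette 1 n -> #|` A| = b -> #|` B| = b ->
  #|` gadget_list b e A B i| = 4 * b + e.
Proof.
move=> AX BY cA cB.
have dis (X Z W : {fset nat * nat}) :
    X `<=` Z -> Z `&` W = fset0 -> X `&` W = fset0.
  by move=> XZ ZW; apply/eqP; rewrite -fsubset0 -ZW fsetSI.
have dAB : A `&` B = fset0.
  rewrite (dis _ _ _ AX) //; rewrite fsetIC (dis _ _ _ BY) //.
  exact: palette_disjoint.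
have dA c m : c != 0 -> A `&` palette c m = fset0.
  by move=> c0; rewrite (dis _ _ _ AX) // palette_disjoint // eq_sym.
have dB c m : c != 1 -> B `&` palette c m = fset0.
  by move=> c0; rewrite (dis _ _ _ BY) // palette_disjoint // eq_sym.
have dP := palette_disjoint.
case: i => [|[|[|[|[|[|i]]]]]]; rewrite /gadget_list /half_list;
rewrite !cardfsU_disjoint ?fsetIUl ?fsetIUr ?dAB ?dA ?dB ?dP ?fsetU0 //;
rewrite !card_palette ?cA ?cB; lia.
Qed.

Definition subsets (K : choiceType) (b : nat) (X : {fset K}) :
    {fset {fset K}} :=
  [fset A in fpowerset X | #|` A| == b].

Lemma subsetsP (K : choiceType) b (X A : {fset K}) :
  reflect (A `<=` X /\ #|` A| = b) (A \in subsets b X).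
Proof. by rewrite !inE fpowersetE; apply: (iffP andP) => -[-> /eqP]. Qed.

Definition half_vertex (c : bool) (i : nat) : 'I_14 :=
  inord (if c then i else 13 - i).

Lemma half_vertexK c i : i < 7 ->
  mirror (half_vertex c i) = i /\ ((half_vertex c i < 7) = c).
Proof. by move=> i7; rewrite /mirror inordK; case: c; try case: ifP; lia. Qed.

Lemma half_edges_lt i j : (i, j) \in half_edges -> (i < 7) && (j < 7).
Proof.
have : all (fun e => (e.1 < 7) && (e.2 < 7)) half_edges by [].
by move=> /allP h /h.
Qed.

Lemma half_pole_lt p i : i \in half_pole p -> i < 7.
Proof.
have : all (fun i => i < 7) (half_pole p) by case: p.
by move=> /allP h /h.
Qed.

Definition gadget_index (a b : nat) : finType :=
  (subsets b (palette 0 a) * subsets b (palette 1 a))%type.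

(** Read as a number, [~~ p] is 0 for the pole [true] and 1 for the pole [false]. *)
Definition bipolar_list (a b e : nat) (v : bipolar (gadget_index a b)) :
    {fset nat * nat} :=
  match v with
  | inl p => palette (~~ p) a
  | inr (g, i) => gadget_list b e (val g.1) (val g.2) (mirror i)
  end.

Lemma bipolar_not_choosable (b e : nat) : 5 * e < 2 * b ->
  ~ choosable (4 * b + e) b (bipolar (gadget_index (4 * b + e) b)).
Proof.
move=> eb; set a := 4 * b + e; move=> /(_ _ (@bipolar_list a b e))[].
  move=> [p|[[A B] i]] /=; first exact: card_palette.
  have /subsetsP[AX cA] := valP A; have /subsetsP[BY cB] := valP B.
  exact: card_gadget_list AX BY cA cB.
move=> phi [phiL phic phiE].
have KA : phi (inl true) \in subsets b (palette 0 a).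
  by apply/subsetsP; split; [exact: (phiL (inl true)) | exact: phic].
have KB : phi (inl false) \in subsets b (palette 1 a).
  by apply/subsetsP; split; [exact: (phiL (inl false)) | exact: phic].
(* The gadget made for the very sets that the colouring gives to the poles. *)
pose g : gadget_index a b := ([` KA], [` KB]).
pose f c i := phi (inr (g, half_vertex c i)).
have bound c : #|` palette 2 (2 * b) `&` f c 6| <= 2 * e.
  apply: (@half_bound _ b e (phi (inl true)) (phi (inl false)) _ (palette 3 e)
    (palette 4 (b + e)) (palette 5 b) (palette 6 (2 * b + e)) (f c));
    rewrite ?card_palette //.
  - by move=> i i7; exact: phic.
  - move=> i i7; have := phiL (inr (g, half_vertex c i)).
    by rewrite /= (half_vertexK c i7).1.
  - move=> i ip; apply: phiE.
    by rewrite /= /pole_adj (half_vertexK c (half_pole_lt ip)).1.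
  - move=> i ip; apply: phiE.
    by rewrite /= /pole_adj (half_vertexK c (half_pole_lt ip)).1.
  - move=> i j ij; apply: phiE; have /andP[i7 j7] := half_edges_lt ij.
    have [mi si] := half_vertexK c i7; have [mj sj] := half_vertexK c j7.
    by rewrite /= eqxx /inner_adj si sj eqxx mi mj ij.
have dis : f true 6 `&` f false 6 = fset0.
  apply: phiE; have [m1 s1] := half_vertexK true (isT : 6 < 7).
  have [m2 s2] := half_vertexK false (isT : 6 < 7).
  by rewrite /= eqxx /inner_adj s1 s2 m1 m2.
have inPE c x : x \in f c 6 ->
    (x \in palette 2 (2 * b)) || (x \in palette 3 e).
  move=> xf; have /fsubsetP/(_ _ xf) := phiL (inr (g, half_vertex c 6)).
  rewrite /= (half_vertexK c (isT : 6 < 7)).1 !in_fsetU.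
  have /(fsetI0_notin (x := x)) : f c 6 `&` phi (inl true) = fset0.
    apply: phiE; by rewrite /= /pole_adj (half_vertexK c (isT : 6 < 7)).1.
  have /(fsetI0_notin (x := x)) : f c 6 `&` phi (inl false) = fset0.
    apply: phiE; by rewrite /= /pole_adj (half_vertexK c (isT : 6 < 7)).1.
  by move=> /(_ xf)/negbTE-> /(_ xf)/negbTE->.
have sub : f true 6 `|` f false 6 `<=`
    (palette 2 (2 * b) `&` f true 6) `|` (palette 2 (2 * b) `&` f false 6)
      `|` palette 3 e.
  apply/fsubsetP => x; rewrite !in_fsetU !in_fsetI => /orP[] xf.
    by rewrite xf andbT; case/orP: (inPE _ _ xf) => ->; rewrite ?orbT.
  by rewrite xf !andbT; case/orP: (inPE _ _ xf) => ->; rewrite ?orbT.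
(* This yields 2b <= 2e + 2e + e, against 5e < 2b. *)
have := leq_trans (fsubset_leq_card sub) (cardfsU_le _ _).
have := cardfsU_le (palette 2 (2 * b) `&` f true 6)
  (palette 2 (2 * b) `&` f false 6).
rewrite (cardfsU_disjoint dis) card_palette !phic.
by have := bound true; have := bound false; lia.
Qed.

(** Each list is cut down to its first [a] colours. *)
Lemma choosable_leq a a' b G : a <= a' -> choosable a b G -> choosable a' b G.
Proof.
move=> le ch C L cL.
pose L' v := [fset x in take a (enum_fset (L v))].
have [v|phi [sub card dis]] := ch C L'.
  rewrite card_fseq undup_id ?size_takel ?take_uniq ?fset_uniq //.
  by rewrite -/(#|` L v|) cL.
exists phi; split=> // v; apply: fsubset_trans (sub v) _.
by apply/fsubsetP => x; rewrite inE => /mem_take.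
Qed.

(** * Straight-line drawings and separating lines *)

Local Open Scope ring_scope.

Definition affine (h : int * int * int) (p : int * int) : int :=
  h.1.1 * p.1 + h.1.2 * p.2 + h.2.

(* A certificate that the open segment pq misses the closed segment rs: strict
   positivity at one end of pq is enough. *)
Definition separates (h : int * int * int) (p q r s : int * int) : bool :=
  [&& 0 <= affine h p, 0 <= affine h q, affine h r <= 0, affine h s <= 0
    & (0 < affine h p + affine h q)
      || (affine h r < 0) && (affine h s < 0)].

Definition segment (R : realType) (p q : int * int) (t : R) : R * R :=
  (p.1%:~R + t * (q.1 - p.1)%:~R, p.2%:~R + t * (q.2 - p.2)%:~R).

(** At a common point [h] would be both >= 0 and <= 0, hence 0. But it is positive inside pq if
    positive at one end, and negative on all of rs if negative at both ends. *)
Lemma separates_segment (R : realType) h p q r s (x y : R) :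
  separates h p q r s -> 0 < x < 1 -> 0 <= y <= 1 ->
  segment p q x <> segment r s y.
Proof.
case: h => [[a b] c]; case: p q r s => [p1 p2] [q1 q2] [r1 r2] [s1 s2].
rewrite /separates /affine /segment /= -!(ler_int R).
move=> + /andP[x0 x1] /andP[y0 y1].
have pos0 (z : int) : (0 < z) = (0 < z%:~R :> R) by rewrite ltr0z.
have neg0 (z : int) : (z < 0) = (z%:~R < 0 :> R) by rewrite ltrz0.
rewrite pos0 !neg0 !rmorphD !rmorphM !rmorphN /=.
move=> /and5P[hp hq hr hs str] [e1 e2].
set P : R := a%:~R * p1%:~R + _ + _ in hp str.
set Q : R := a%:~R * q1%:~R + _ + _ in hq str.
set U : R := a%:~R * r1%:~R + _ + _ in hr str.
set S : R := a%:~R * s1%:~R + _ + _ in hs str.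
have E : (1 - x) * P + x * Q = (1 - y) * U + y * S.
  rewrite /P /Q /U /S.
  transitivity (a%:~R * (p1%:~R + x * (q1%:~R - p1%:~R))
    + b%:~R * (p2%:~R + x * (q2%:~R - p2%:~R)) + c%:~R : R); first by ring.
  by rewrite e1 e2; ring.
move: P Q U S hp hq hr hs str E => P Q U S hp hq hr hs str E.
have x1' : 0 < 1 - x by lra.
have y1' : 0 <= 1 - y by lra.
have P0 := mulr_ge0 (ltW x1') hp; have Q0 := mulr_ge0 (ltW x0) hq.
have U0 := mulr_ge0_le0 y1' hr; have S0 := mulr_ge0_le0 y0 hs.
case/orP: str => [pq|/andP[r0 s0]].
- have [Pp|Pn] := ltP 0 P.
    by have := mulr_gt0 x1' Pp; lra.
  have Qp : 0 < Q by lra.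
  by have := mulr_gt0 x0 Qp; lra.
- have [y0'|yn] := ltP 0 y.
    have := mulr_gt0 y0' (_ : 0 < - S).
    by rewrite oppr_gt0 mulrN => /(_ s0); lra.
  have yE : y = 0 by lra.
  by move: E; rewrite yE subr0 mul1r mul0r; lra.
Qed.

Lemma separatesC h p q r s : separates h p q r s = separates h q p r s.
Proof. by rewrite /separates andbCA addrC. Qed.

(** With normal vector q - p, the form vanishes at [p] and equals the squared length of pq at
    [q]. *)
Lemma separates_endpoint p q : p != q -> exists h, separates h p q p p.
Proof.
case: p q => [p1 p2] [q1 q2]; rewrite xpair_eqE negb_and => pq.
pose h := (q1 - p1, q2 - p2, - (q1 - p1) * p1 - (q2 - p2) * p2); exists h.
have zp : affine h (p1, p2) = 0 by rewrite /affine /=; ring.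
rewrite /separates zp lexx /= add0r.
have -> : affine h (q1, q2) = (q1 - p1) ^+ 2 + (q2 - p2) ^+ 2.
  by rewrite /affine /=; ring.
rewrite addr_ge0 ?sqr_ge0 //= orbF lt_neqAle addr_ge0 ?sqr_ge0 // andbT eq_sym.
rewrite paddr_eq0 ?sqr_ge0 // !sqrf_eq0 !subr_eq0 negb_and.
by rewrite ![q1 == _]eq_sym ![q2 == _]eq_sym.
Qed.

Lemma straight_line_planar (R : realType) (G : sgraph) (c : G -> int * int) :
  injective c ->
  (forall u v w, adj u v -> w != u -> w != v ->
     exists h, separates h (c u) (c v) (c w) (c w)) ->
  (forall u v x y, adj u v -> adj x y -> [set u; v]%SET != [set x; y]%SET ->
     exists h, separates h (c u) (c v) (c x) (c y)) ->
  planar R G.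
Proof.
move=> cI sepv sepe.
have seg0 p q : segment p q (0 : R) = (p.1%:~R, p.2%:~R).
  by rewrite /segment !mul0r !addr0.
have seg1 p q : segment p q (1 : R) = (q.1%:~R, q.2%:~R).
  by rewrite /segment !mul1r !rmorphB /= !subrKC.
have posI (p q : int * int) :
    (p.1%:~R, p.2%:~R) = (q.1%:~R, q.2%:~R) :> R * R -> p = q.
  by case: p q => [p1 p2] [q1 q2] /= [/intr_inj-> /intr_inj->].
have neq (u v : G) : adj u v -> u != v.
  by apply: contraTneq => ->; rewrite adj_irr.
exists (fun v => ((c v).1%:~R, (c v).2%:~R)).
exists (fun u v => segment (c u) (c v)).
split.
- by move=> u v /posI/cI.
- move=> u v _; apply: continuous_subspaceT => t.
  have line (d e : R) : {for t, continuous (fun x : R => d + x * e)}.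
    by apply: cvgD; [exact: cvg_cst | apply: cvgMr_tmp; exact: cvg_id].
  exact: (cvg_pair (line _ _) (line _ _)).
- move=> u v uv s t _ _ [].
  move=> /addrI e1 /addrI e2.
  have [//|st] := eqVneq s t; case/eqP: (neq _ _ uv); apply: cI.
  have z (d : int) : s * d%:~R = t * d%:~R -> d = 0.
    move/eqP; rewrite -subr_eq0 -mulrBl mulf_eq0 subr_eq0 (negbTE st) /=.
    by rewrite intr_eq0 => /eqP.
  move: (z _ e1) (z _ e2) => /subr0_eq + /subr0_eq.
  by case: (c u) (c v) => [? ?] [? ?] /= -> ->.
- by move=> u v _; rewrite seg0.
- by move=> u v _; rewrite seg1.
- move=> u v _ t _; rewrite /segment !rmorphB /=.
  by congr (_, _); ring.
- move=> u v w uv t; rewrite in_itv /= => t01.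
  have [h sep] : exists h, separates h (c u) (c v) (c w) (c w).
    have cuv : c u != c v by apply: contraNneq (neq _ _ uv) => /cI->.
    have [->|wu] := eqVneq w u; first exact: separates_endpoint.
    have [->|wv] := eqVneq w v; last exact: sepv.
    rewrite eq_sym in cuv; have [h sep] := separates_endpoint cuv.
    by exists h; rewrite separatesC.
  (* The second segment is the single point [c w], reached at parameter 0. *)
  have := separates_segment sep t01 (y := 0).
  by rewrite seg0; apply; rewrite lexx ler01.
- move=> u v x y uv xy ne s t; rewrite !in_itv /= => s01 t01.
  by have [h /separates_segment/(_ s01 t01)] := sepe _ _ _ _ uv xy ne.
Qed.

(** * Lines through the poles and through points of the strip *)

Definition affine_scale (c : int) (h : int * int * int) : int * int * int :=
  (c * h.1.1, c * h.1.2, c * h.2).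

Lemma affineZ c h p : affine (affine_scale c h) p = c * affine h p.
Proof. by rewrite /affine /=; ring. Qed.

Definition sgb (p : bool) : int := if p then 1 else -1.

Definition pole (M : int) (p : bool) : int * int := (0, sgb p * M).

(* The points close to the horizontal axis, from which the poles, at height M
   and -M, are seen in nearly vertical directions. *)
Definition in_strip (M : int) (u : int * int) : bool :=
  [&& 1 <= u.1, 4 * u.1 + 3 < M, -1 <= u.2 & u.2 <= 1].

(** The line through the pole and [u], signed to be positive on the right. *)
Definition pole_line (M : int) (p : bool) (u : int * int) : int * int * int :=
  (M - sgb p * u.2, sgb p * u.1, - (M * u.1)).

Lemma pole_line_pole M p u : affine (pole_line M p u) (pole M p) = 0.
Proof. by case: p; rewrite /affine /pole_line /pole /sgb /=; ring. Qed.

Lemma pole_line_self M p u : affine (pole_line M p u) u = 0.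
Proof. by rewrite /affine /pole_line /=; ring. Qed.

Lemma pole_line_opp M p u : in_strip M u ->
  affine (pole_line M p u) (pole M (~~ p)) < 0.
Proof.
case: u => s t /and4P[/= s1 sM _ _].
by case: p; rewrite /affine /pole_line /pole /sgb /=; nia.
Qed.

(** Heights are at most 1 in absolute value, so for w.1 = s + 1 + d the value is at least M(1 + d) -
    (2s + 1 + d), and M exceeds 2s + 1 + d. *)
Lemma pole_line_right M p u w : in_strip M u -> in_strip M w -> u.1 < w.1 ->
  0 < affine (pole_line M p u) w.
Proof.
case: u w => [s t] [s' t'] /and4P[/= s1 sM t1 t1'] /and4P[/= s2 sM' t2 t2'] lt.
have [d [dE d0]] : exists d, s' = s + 1 + d /\ 0 <= d.
  by exists (s' - s - 1); split; lia.
rewrite {}dE /affine /pole_line /= in sM' *.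
have pt : -1 <= sgb p * t <= 1 by case: (p); rewrite /sgb; lia.
have pt' : -1 <= sgb p * t' <= 1 by case: (p); rewrite /sgb; lia.
have -> : (M - sgb p * t) * (s + 1 + d) + sgb p * s * t' + - (M * s)
  = M + M * d - (sgb p * t) * (s + 1 + d) + s * (sgb p * t') by ring.
move: pt pt'; move: (sgb p * t) (sgb p * t') => x y pt pt'; nia.
Qed.

Lemma pole_line_left M p u w : in_strip M u -> in_strip M w -> w.1 < u.1 ->
  affine (pole_line M p u) w < 0.
Proof.
case: u w => [s t] [s' t'] /and4P[/= s1 sM t1 t1'] /and4P[/= s2 sM' t2 t2'] lt.
have [d [dE d0]] : exists d, s = s' + 1 + d /\ 0 <= d.
  by exists (s - s' - 1); split; lia.
rewrite {}dE /affine /pole_line /= in sM s1 *.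
have pt : -1 <= sgb p * t <= 1 by case: (p); rewrite /sgb; lia.
have pt' : -1 <= sgb p * t' <= 1 by case: (p); rewrite /sgb; lia.
have -> : (M - sgb p * t) * s' + sgb p * (s' + 1 + d) * t'
    + - (M * (s' + 1 + d))
  = (s' + 1 + d) * (sgb p * t') - (sgb p * t) * s' - M - M * d by ring.
move: pt pt'; move: (sgb p * t) (sgb p * t') => x y pt pt'; nia.
Qed.

(** The value at v is the cross product of w - u and v - u: positive above the line uw when [u] is
    left of [w]. *)
Definition chord (u w : int * int) : int * int * int :=
  (u.2 - w.2, w.1 - u.1, (w.2 - u.2) * u.1 - u.2 * (w.1 - u.1)).

Lemma chord_src u w : affine (chord u w) u = 0.
Proof. by rewrite /affine /chord /=; ring. Qed.

Lemma chord_tgt u w : affine (chord u w) w = 0.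
Proof. by rewrite /affine /chord /=; ring. Qed.

(** A chord has slope at most 2 in absolute value, so it meets the vertical axis within distance 1 +
    2s of the origin, where s = u.1, and this is below [M]. *)
Lemma chord_pole M p u w : in_strip M u -> in_strip M w -> u.1 < w.1 ->
  0 < sgb p * affine (chord u w) (pole M p).
Proof.
case: u w => [s t] [s' t'] /and4P[/= s1 sM t1 t1'] /and4P[/= s2 sM' t2 t2'] lt.
have [d [dE d0]] : exists d, s' = s + 1 + d /\ 0 <= d.
  by exists (s' - s - 1); split; lia.
rewrite {}dE /affine /chord /pole /= in sM' *.
by case: p; rewrite /sgb; nia.
Qed.

(** * Coordinates of one gadget, checked by computation *)

Definition height (i : nat) : int :=
  nth 0 [:: 0; 1; -1; 0; 1; -1; 0] (mirror i).

(** A vertex has height 1 if adjacent to the upper pole only, -1 if to the lower only, and 0 if to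
    both. *)
Definition local (i : nat) : int * int := (i%:Z, height i).

(* The separating line is the one through r and s, a parallel to the one through
   p and q (chords being integral, a shift by 1/2 is safe), or, for collinear
   segments sharing an end, vertical. *)
Definition candidates (p q r s : int * int) : seq (int * int * int) :=
  let h := affine_scale 2 (chord p q) in
  [:: chord r s; affine_scale (-1) (chord r s);
      (h.1, h.2 + 1); ((affine_scale (-1) h).1, 1 - h.2);
      (1, 0, - r.1); (1, 0, - s.1); (-1, 0, r.1); (-1, 0, s.1)].

Definition inner_check : bool :=
  all (fun i => all (fun j => inner_adj i j ==>
    all (fun k => all (fun l =>
      inner_adj k l && ~~ [|| (i == k) && (j == l) | (i == l) && (j == k)] ==>
      has (fun h => separates h (local i) (local j) (local k) (local l))
        (candidates (local i) (local j) (local k) (local l)))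
    (iota 0 14)) (iota 0 14)) (iota 0 14)) (iota 0 14).

Lemma inner_checkT : inner_check.
Proof. by vm_compute. Qed.

(** An edge from a pole comes down almost vertically, so it misses the edges spanning its lower end
    [k] if [k] lies on the pole's side of them. *)
Definition between_check : bool :=
  all (fun i => all (fun j => inner_adj i j ==>
    all (fun k => (i < k < j)%N ==>
      let z := affine (chord (local i) (local j)) (local k) in
      [&& z != 0, pole_adj true k ==> (0 < z) & pole_adj false k ==> (z < 0)])
    (iota 0 14)) (iota 0 14)) (iota 0 14).

Lemma between_checkT : between_check.
Proof. by vm_compute. Qed.

(** * Separation for each kind of pair of edges *)

Definition separable (p q r s : int * int) : Prop :=
  exists h, separates h p q r s.

Lemma separableCl p q r s : separable p q r s -> separable q p r s.
Proof. by case=> h; exists h; rewrite separatesC. Qed.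

Lemma separableCr p q r s : separable p q r s -> separable p q s r.
Proof.
case=> h /and5P[hp hq hr hs str]; exists h; rewrite /separates hp hq hr hs /=.
by rewrite [X in _ || X]andbC.
Qed.

Lemma separable_shift d p q r s : separable p q r s ->
  separable (p.1 + d, p.2) (q.1 + d, q.2) (r.1 + d, r.2) (s.1 + d, s.2).
Proof.
case=> h H; exists (h.1, h.2 - h.1.1 * d).
have E z : affine (h.1, h.2 - h.1.1 * d) (z.1 + d, z.2) = affine h z.
  by rewrite /affine /=; ring.
by rewrite /separates !E.
Qed.

(** A line through [w] and a pole separates. If the poles differ, it is the pole [q] when [v] is
    left of [w] and [p] when [v] is right of it, since the other pole always lies on the left. *)
Lemma separable_fan M p q v w : in_strip M v -> in_strip M w -> v.1 != w.1 ->
  separable (pole M p) v (pole M q) w.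
Proof.
move=> sv sw; have [<-|/eqP pq] := eqVneq p q.
  have := pole_line_pole M p w; have := pole_line_self M p w.
  case: ltgtP => // [lt|gt] z0 z1 _.
    exists (affine_scale (-1) (pole_line M p w)); rewrite /separates !affineZ.
    by have := pole_line_left p sw sv lt; lia.
  exists (pole_line M p w); rewrite /separates.
  by have := pole_line_right p sw sv gt; lia.
have -> : q = ~~ p by move: pq; case: p; case: q.
case: ltgtP => // [lt|gt] _.
  exists (affine_scale (-1) (pole_line M (~~ p) w)).
  rewrite /separates !affineZ.
  have := pole_line_opp (~~ p) sw; rewrite negbK.
  have := pole_line_pole M (~~ p) w; have := pole_line_self M (~~ p) w.
  by have := pole_line_left (~~ p) sw sv lt; lia.
exists (pole_line M p w); rewrite /separates.
have := pole_line_opp p sw; have := pole_line_self M p w.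
have := pole_line_pole M p w.
by have := pole_line_right p sw sv gt; lia.
Qed.

Lemma separable_path M p v : in_strip M v ->
  separable (pole M p) v (pole M (~~ p)) v.
Proof.
(* The horizontal line through [v]. *)
case: v => s t /and4P[/= s1 sM t1 t1']; exists (0, sgb p, - (sgb p * t)).
by case: p; rewrite /separates /affine /pole /sgb /=; lia.
Qed.

Lemma separable_pole_point M p v w :
  in_strip M v -> in_strip M w -> v.1 != w.1 ->
  separable (pole M p) v w w.
Proof.
move=> sv sw; have := pole_line_pole M p w; have := pole_line_self M p w.
case: ltgtP => // [lt|gt] z0 z1 _.
  exists (affine_scale (-1) (pole_line M p w)); rewrite /separates !affineZ.
  by have := pole_line_left p sw sv lt; lia.
exists (pole_line M p w); rewrite /separates.
by have := pole_line_right p sw sv gt; lia.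
Qed.

Lemma separable_pole_pole M p v : in_strip M v ->
  separable (pole M p) v (pole M (~~ p)) (pole M (~~ p)).
Proof.
(* The horizontal border of the strip that is farther from the pole [p]. *)
case: v => s t /and4P[/= s1 sM t1 t1']; exists (0, sgb p, 1).
by case: p; rewrite /separates /affine /pole /sgb /=; lia.
Qed.

Lemma separable_pole_edge M p v u w :
  in_strip M v -> in_strip M u -> in_strip M w -> u.1 < w.1 ->
  [|| v.1 < u.1, w.1 < v.1 | 0 <= sgb p * affine (chord u w) v] ->
  separable (pole M p) v u w.
Proof.
move=> sv su sw uw /or3P[lt|gt|up].
- exists (affine_scale (-1) (pole_line M p u)); rewrite /separates !affineZ.
  have := pole_line_pole M p u; have := pole_line_self M p u.
  by have := pole_line_left p su sv lt; have := pole_line_right p su sw uw; lia.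
- exists (pole_line M p w); rewrite /separates.
  have := pole_line_pole M p w; have := pole_line_self M p w.
  by have := pole_line_right p sw sv gt; have := pole_line_left p sw su uw; lia.
- exists (affine_scale (sgb p) (chord u w)); rewrite /separates !affineZ.
  rewrite chord_src chord_tgt mulr0.
  by have := chord_pole p su sw uw; lia.
Qed.

(** Now the closed segment is the one from the pole, so its end [v] must be avoided too: the
    inequality is strict, and [v] being an end of uw needs the line from the pole to [v]. *)
Lemma separable_edge_pole M p v u w :
  in_strip M v -> in_strip M u -> in_strip M w -> u.1 < w.1 ->
  [|| v == u, v == w, v.1 < u.1, w.1 < v.1
    | 0 < sgb p * affine (chord u w) v] ->
  separable u w (pole M p) v.
Proof.
move=> sv su sw uw; have := pole_line_pole M p v; have := pole_line_self M p v.
move=> z0 z1 /or4P[/eqP vu|/eqP vw|lt|/orP[gt|up]].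
- exists (pole_line M p v); rewrite /separates; subst v.
  by have := pole_line_right p su sw uw; lia.
- exists (affine_scale (-1) (pole_line M p v)); subst v.
  rewrite /separates !affineZ.
  by have := pole_line_left p sw su uw; lia.
- exists (pole_line M p v); rewrite /separates.
  have := pole_line_right p sv sw (lt_trans lt uw).
  by have := pole_line_right p sv su lt; lia.
- exists (affine_scale (-1) (pole_line M p v)); rewrite /separates !affineZ.
  have := pole_line_left p sv su (lt_trans uw gt).
  by have := pole_line_left p sv sw gt; lia.
- exists (affine_scale (- sgb p) (chord u w)); rewrite /separates !affineZ.
  rewrite chord_src chord_tgt mulr0 !mulNr.
  by have := chord_pole p su sw uw; lia.
Qed.

Lemma separable_edge_apex M p u w : in_strip M u -> in_strip M w -> u.1 < w.1 ->
  separable u w (pole M p) (pole M p).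
Proof.
move=> su sw uw; exists (affine_scale (- sgb p) (chord u w)).
rewrite /separates !affineZ chord_src chord_tgt mulr0 !mulNr.
by have := chord_pole p su sw uw; lia.
Qed.

Lemma separable_edge_point u w v : u.1 < w.1 ->
  [|| v.1 < u.1, w.1 < v.1 | affine (chord u w) v != 0] -> separable u w v v.
Proof.
case: u w v => [s t] [s' t'] [x y] /= uw /or3P[lt|gt|].
- by exists (1, 0, - x); rewrite /separates /affine /=; lia.
- by exists (-1, 0, x); rewrite /separates /affine /=; lia.
case: ltgtP => // [lt|gt] _.
  exists (chord (s, t) (s', t')).
  by rewrite /separates chord_src chord_tgt lexx (ltW lt) lt orbT.
exists (affine_scale (-1) (chord (s, t) (s', t'))).
rewrite /separates !affineZ chord_src chord_tgt mulr0 mulN1r.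
by rewrite oppr_lt0 oppr_le0 lexx (ltW gt) gt orbT.
Qed.

(** * Drawing the whole graph *)

Definition bipolar_height (I : finType) : int := (56 * #|I|.+1)%N%:Z.

(** The gadget of rank r fills the abscissas 14r + 1 to 14r + 14; the successor keeps it strictly
    right of the poles. *)
Definition bipolar_pos (I : finType) (v : bipolar I) : int * int :=
  match v with
  | inl p => pole (bipolar_height I) p
  | inr gi => ((14 * enum_rank gi.1 + gi.2).+1%:Z, height gi.2)
  end.

Lemma height_bound i : -1 <= height i <= 1.
Proof. by rewrite /height; case: (mirror i) => [|[|[|[|[|[|[|[|m]]]]]]]]. Qed.

(** Abscissas are at most 14n for n gadgets, and 4 * 14n + 3 < 56(n + 1). *)
Lemma bipolar_pos_strip (I : finType) (gi : I * 'I_14) :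
  in_strip (bipolar_height I) (bipolar_pos (inr gi)).
Proof.
rewrite /in_strip /bipolar_height /=; move: #|I| (enum_rank gi.1) => n r.
have := height_bound gi.2; have := ltn_ord gi.2; have := ltn_ord r.
by move: (height _) => z; lia.
Qed.

Lemma bipolar_pos_local (I : finType) (g : I) (i : 'I_14) :
  bipolar_pos (inr (g, i)) =
    ((local i).1 + (14 * enum_rank g).+1%:Z, (local i).2).
Proof. by rewrite /= -PoszD addnS addnC. Qed.

Lemma bipolar_pos_between (I : finType) (g h : I) (i j k : 'I_14) :
  (bipolar_pos (inr (g, i))).1 <= (bipolar_pos (inr (h, k))).1
    <= (bipolar_pos (inr (g, j))).1 -> h = g /\ (i <= k <= j)%N.
Proof.
rewrite /= !lez_nat !ltnS => le.
have E : enum_rank h = enum_rank g :> nat.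
  have := ltn_ord i; have := ltn_ord j; have := ltn_ord k.
  by move: (nat_of_ord (enum_rank h)) (nat_of_ord (enum_rank g)) le => r s; lia.
move: le; rewrite E !leq_add2l => ikj; split=> //.
exact/enum_rank_inj/val_inj.
Qed.

Lemma bipolar_pos_eq1 (I : finType) (u v : I * 'I_14) :
  (bipolar_pos (inr u)).1 = (bipolar_pos (inr v)).1 -> u = v.
Proof.
case: u v => [g i] [h k] E.
have [hg /andP[ki ik]] : h = g /\ (i <= k <= i)%N.
  by apply: bipolar_pos_between; rewrite E lexx.
by rewrite hg; congr (_, _); apply/val_inj/eqP; rewrite eqn_leq /= ki ik.
Qed.

Lemma affine_chord_shift d u w v :
  affine (chord (u.1 + d, u.2) (w.1 + d, w.2)) (v.1 + d, v.2) =
  affine (chord u w) v.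
Proof. by rewrite /affine /chord /=; ring. Qed.

Lemma mem_iota14 (i : 'I_14) : (i : nat) \in iota 0 14.
Proof. by rewrite mem_iota ltn_ord. Qed.

(** Leaves two kinds of edges to consider: from a pole into a gadget, and from left to right inside
    a gadget. *)
Lemma bipolar_edge_ind (I : finType) (P : bipolar I -> bipolar I -> Prop) :
  (forall u v, P u v -> P v u) ->
  (forall p (gi : I * 'I_14), pole_adj p gi.2 -> P (inl p) (inr gi)) ->
  (forall g (i j : 'I_14), (i < j)%N -> inner_adj i j ->
     P (inr (g, i)) (inr (g, j))) ->
  forall u v, adj u v -> P u v.
Proof.
move=> sym Pp Pi [p|[g i]] [q|[h j]] //=; first exact: (Pp p (h, j)).
  by move/(Pp q (g, i))/sym.
move=> /andP[/eqP/= gh /= ij]; subst h.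
case: (ltngtP i j) => [lt|gt|/val_inj eq].
- exact: Pi.
- apply/sym/Pi => //.
  have := bipolar_adj_sym (inr (g, i)) (inr (g, j)).
  by rewrite /= eqxx /= ij => <-.
- by have := bipolar_adj_irr (inr (g, i)); rewrite /= eqxx {2}eq /= ij.
Qed.

(** A vertex not beside the edge lies in the same gadget, strictly between [i] and [j], so
    [between_checkT] applies after a translation. *)
Lemma bipolar_between (I : finType) (g : I) (i j : 'I_14) (hk : I * 'I_14) :
  inner_adj i j -> hk != (g, i) -> hk != (g, j) ->
  let c v := bipolar_pos (inr v) in
  let z := affine (chord (c (g, i)) (c (g, j))) (c hk) in
  [\/ (c hk).1 < (c (g, i)).1, (c (g, j)).1 < (c hk).1
    | z != 0 /\ forall p, pole_adj p hk.2 -> 0 < sgb p * z].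
Proof.
move=> ij ni nj c z.
have [lt|ge] := ltP (c hk).1 (c (g, i)).1; first by constructor 1.
have [lt|le] := ltP (c (g, j)).1 (c hk).1; first by constructor 2.
constructor 3; case: hk @z ni nj ge le => h k z ni nj ge le.
have [hg /andP[ik kj]] : h = g /\ (i <= k <= j)%N.
  by apply: bipolar_pos_between; rewrite ge le.
subst h.
have ik' : (i < k)%N.
  by rewrite ltn_neqAle ik andbT; apply: contraNneq ni => /val_inj->.
have kj' : (k < j)%N.
  by rewrite ltn_neqAle kj andbT; apply: contraNneq nj => /val_inj->.
have zE : z = affine (chord (local i) (local j)) (local k).
  by rewrite /z /c !bipolar_pos_local affine_chord_shift.
have /allP/(_ _ (mem_iota14 i)) := between_checkT.
move=> /allP/(_ _ (mem_iota14 j))/implyP/(_ ij).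
move=> /allP/(_ _ (mem_iota14 k))/implyP/(_ (introT andP (conj ik' kj'))).
rewrite -zE.
move=> /and3P[z0 /implyP zp /implyP zm]; split => // -[/= /zp|/= /zm].
  by rewrite mul1r.
by rewrite mulN1r oppr_gt0.
Qed.

Lemma separable_inner (I : finType) (g h : I) (i j k l : 'I_14) :
  (i < j)%N -> (k < l)%N -> inner_adj i j -> inner_adj k l ->
  [|| g != h, i != k | j != l] ->
  separable (bipolar_pos (inr (g, i))) (bipolar_pos (inr (g, j)))
    (bipolar_pos (inr (h, k))) (bipolar_pos (inr (h, l))).
Proof.
move=> ij kl adij adkl; have [<- ne|gh _] := eqVneq g h.
  rewrite !bipolar_pos_local; apply: separable_shift.
  have /allP/(_ _ (mem_iota14 i)) := inner_checkT.
  move=> /allP/(_ _ (mem_iota14 j))/implyP/(_ adij).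
  move=> /allP/(_ _ (mem_iota14 k))/allP/(_ _ (mem_iota14 l))/implyP.
  (* As i < j and k < l, the two edges cannot coincide with ends swapped. *)
  have distinct : inner_adj k l &&
      ~~ [|| (i == k :> nat) && (j == l :> nat)
          | (i == l :> nat) && (j == k :> nat)].
    by rewrite adkl /=; move: ne; rewrite -!val_eqE /=; lia.
  move=> /(_ distinct).
  by case/hasP => c _ sep; exists c.
have neq : enum_rank g != enum_rank h by apply: contra_neq gh => /enum_rank_inj.
have := ltn_ord i; have := ltn_ord j; have := ltn_ord k; have := ltn_ord l.
move: neq; rewrite neq_ltn /bipolar_pos /=.
move: (nat_of_ord (enum_rank g)) (nat_of_ord (enum_rank h)) => r s.
move=> /orP[] rs ll lk lj li.
(* The vertical line at abscissa 14s + 1/2, just before the right-hand gadget, doubled to be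
   integral. *)
- by exists (-2, 0, (28 * s + 1)%N%:Z); rewrite /separates /affine /=; lia.
- by exists (2, 0, - (28 * r + 1)%N%:Z); rewrite /separates /affine /=; lia.
Qed.

(** [bipolar_edge_ind] is applied to each of the two edges, which leaves four cases, one for each
    kind of pair. *)
Lemma bipolar_planar (R : realType) (I : finType) : planar R (bipolar I).
Proof.
have strip := @bipolar_pos_strip I.
have neq1 (u v : I * 'I_14) : u != v ->
    (bipolar_pos (inr u)).1 != (bipolar_pos (inr v)).1.
  by apply: contra_neq => /bipolar_pos_eq1.
have lt1 (g : I) (i j : 'I_14) : (i < j)%N ->
    (bipolar_pos (inr (g, i))).1 < (bipolar_pos (inr (g, j))).1.
  by move=> /=; lia.
apply: (@straight_line_planar _ _ (@bipolar_pos I)).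
- move=> [p|u] [q|v] E; [ | by case: E | by case: E |].
    move: E; rewrite /= /pole /sgb /bipolar_height.
    by case: p; case: q => // -[]; lia.
  by congr inr; apply: bipolar_pos_eq1; rewrite E.
- move=> u v w; move: u v.
  pose P (u v : bipolar I) := w != u -> w != v ->
    separable (bipolar_pos u) (bipolar_pos v) (bipolar_pos w) (bipolar_pos w).
  apply: (@bipolar_edge_ind I P); rewrite /P => {P}.
  + by move=> u v H wv wu; apply/separableCl/H.
  + move=> p gi _; case: w => [q|hk] qp hkgi.
      have -> : q = ~~ p by move: qp {hkgi}; case: p; case: q.
      exact/separable_pole_pole/strip.
    apply: separable_pole_point => //; apply: neq1; rewrite eq_sym.
    by apply: contraNneq hkgi => ->.
  + move=> g i j ij aij; case: w => [q|hk] ni nj.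
      exact: (separable_edge_apex _ (strip _) (strip _) (lt1 _ _ _ ij)).
    apply: separable_edge_point; first exact: lt1.
    have nk : hk != (g, i) by apply: contraNneq ni => ->.
    have nl : hk != (g, j) by apply: contraNneq nj => ->.
    have [->|->|[-> _]] := bipolar_between aij nk nl; by rewrite ?orbT.
- move=> u v x y uv xy; move: u v uv.
  pose P (u v : bipolar I) := [set u; v]%SET != [set x; y]%SET ->
    separable (bipolar_pos u) (bipolar_pos v) (bipolar_pos x) (bipolar_pos y).
  apply: (@bipolar_edge_ind I P); rewrite /P => {P}.
  + by move=> u v H; rewrite finset.setUC => /H/separableCl.
  + move=> p gi pgi; move: x y xy.
    pose P (x y : bipolar I) :=
        [set (inl p : bipolar I); (inr gi : bipolar I)]%SET
          != [set x; y]%SET ->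
      separable (@bipolar_pos I (inl p)) (bipolar_pos (inr gi))
        (bipolar_pos x) (bipolar_pos y).
    apply: (@bipolar_edge_ind I P); rewrite /P => {P}.
    * by move=> x y H; rewrite [X in _ != X]finset.setUC => /H/separableCr.
    * move=> q hk qhk ne; have [E|/neq1 ne1] := eqVneq gi hk; last first.
        exact: separable_fan.
      (* Distinct edges with the same lower end come from opposite poles. *)
      subst hk; have -> : q = ~~ p.
        by move: ne; case: p {pgi}; case: q {qhk}; rewrite ?eqxx.
      exact: separable_path.
    * move=> h k l kl akl _; apply: separable_pole_edge => //; first exact: lt1.
      have [->|nk] := eqVneq gi (h, k).
        by rewrite chord_src mulr0 lexx !orbT.
      have [->|nl] := eqVneq gi (h, l).
        by rewrite chord_tgt mulr0 lexx !orbT.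
      have [->|->|[_ /(_ _ pgi)/ltW ->]] := bipolar_between akl nk nl;
        by rewrite ?orbT.
  + move=> g i j ij aij; move: x y xy.
    pose P (x y : bipolar I) :=
        [set (inr (g, i) : bipolar I); (inr (g, j) : bipolar I)]%SET
          != [set x; y]%SET ->
      separable (bipolar_pos (inr (g, i))) (bipolar_pos (inr (g, j)))
        (bipolar_pos x) (bipolar_pos y).
    apply: (@bipolar_edge_ind I P); rewrite /P => {P}.
    * by move=> x y H; rewrite [X in _ != X]finset.setUC => /H/separableCr.
    * move=> q hk qhk _; apply: separable_edge_pole => //; first exact: lt1.
      have [->|nk] := eqVneq hk (g, i); first by rewrite eqxx.
      have [->|nl] := eqVneq hk (g, j); first by rewrite eqxx orbT.
      have [->|->|[_ /(_ _ qhk) ->]] := bipolar_between aij nk nl;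
        by rewrite ?orbT.
    * move=> h k l kl akl ne; apply: separable_inner => //; apply: contraNT ne.
      by rewrite !negb_or !negbK => /and3P[/eqP-> /eqP-> /eqP->].
Qed.

Theorem theorem3p1 (R : realType) (a b : nat) (ha : (0 < a)%N) (hb : (0 < b)%N)
    (hab : (a%:R / b%:R : rat) < 22%:R / 5%:R) :
  exists G : sgraph, planar R G /\ ~ choosable a b G.
Proof.
have {}hab : (5 * a < 22 * b)%N.
  move: hab; rewrite ltr_pdivrMr ?ltr0n // mulrAC ltr_pdivlMr ?ltr0n //.
  by rewrite -!natrM ltr_nat mulnC.
(* Truncated subtraction: [e = 0] when [a < 4 * b]. *)
pose e := (a - 4 * b)%N.
exists (bipolar (gadget_index (4 * b + e) b)).
split; first exact: bipolar_planar.
have le : (a <= 4 * b + e)%N by rewrite /e; lia.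
(* 5e < 2b is 5a < 22b when a >= 4b, and otherwise it is 0 < 2b. *)
by move=> /(choosable_leq le); apply: bipolar_not_choosable; rewrite /e; lia.
Qed.
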